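(* Let $G$ be an MP-forest, with multipath matroid $M_G$ and rank function $r$. Then $$\chi_\mu(G,\alpha)=(-1)^{r(E(G))}\,\alpha^{|E(G)|-r(E(G))}\,\alpha^{p_0(G)}\,T_{M_G}(1-\alpha,1),$$ where $p_0(G)$ is the number of connected components of $G$.
   Context: Digraphs: finite, at most one edge $(v,w)$ from $v$ to $w$ for distinct $v,w$. A simple path is a sequence of non-loop edges $e_1,\dots,e_n$ with target of $e_i$ = source of $e_{i+1}$, no repeated vertices, not closing into a cycle. A multipath of $G$ is a spanning subgraph each of whose connected components is a single vertex or a simple path; $\mathrm{Mult}(G)$ denotes the set of multipaths (identified with edge sets). An MP-digraph is a digraph $G$ such that (MP1) $G$ has no subgraph isomorphic to $D_A$ (vertices $v_0,v_1,v_2$, edges $(v_1,v_0),(v_0,v_2),(v_1,v_2)$) or $D_B$ (vertices $v_0,\dots,v_3$, edges $(v_0,v_1),(v_2,v_1),(v_2,v_3)$) or their edge-reversals, and (MP2) every coherently oriented cycle of length $\ge2$ (distinct vertices $v_1,\dots,v_n$, edges $(v_i,v_{i+1})$ and $(v_n,v_1)$) is a connected component of $G$; then $M_G=(E(G),\mathrm{Mult}(G))$ is a matroid, whose rank function $r(A)$ is the largest size of a multipath contained in $A$. An MP-forest is an MP-digraph whose underlying undirected graph is a forest. Tutte polynomial: $T_M(x,y)=\sum_{A\subseteq X}(x-1)^{r(X)-r(A)}(y-1)^{|A|-r(A)}$. Multipath cohomology of $G$ with coefficients in a $\mathbb Z$-graded finitely generated algebra $A$ over an integral domain $R$ is the cohomology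 of the complex $C^i_\mu(G;A)=\bigoplus_{m\in\mathrm{Mult}(G),\,|E(m)|=i}A^{\otimes p_0(m)}$ (with differential induced by multiplication in $A$); its graded Euler characteristic, with $\alpha$ the graded (quantum) dimension of $A$, equals $\chi_\mu(G,\alpha)=\sum_{m\in\mathrm{Mult}(G)}(-1)^{|E(m)|}\alpha^{p_0(m)}$, where $p_0(m)$ is the number of connected components of the spanning subgraph $m$ (isolated vertices included). One may take this formula as the definition of $\chi_\mu(G,\alpha)$, with $\alpha$ a formal variable. *)

(* Defs.v *)
From mathcomp Require Import all_boot all_order all_algebra.

Set Implicit Arguments.
Unset Strict Implicit.
Unset Printing Implicit Defensive.

(* Loops, even several at one vertex, are allowed; distinct parallel non-loop
   edges are not. *)
Record digraph := Digraph {
  vertex : finType;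
  edge : finType;
  src : edge -> vertex;
  tgt : edge -> vertex;
  edge_simple : forall e f : edge,
    src e <> tgt e -> src e = src f -> tgt e = tgt f -> e = f
}.

Arguments src {d} e.
Arguments tgt {d} e.

Section SpanningSubgraphs.

Variable G : digraph.
Implicit Types (A : {set edge G}) (u v : vertex G) (e f : edge G).

Definition joins e u v : bool :=
  ((src e == u) && (tgt e == v)) || ((src e == v) && (tgt e == u)).

(* A set of edges A stands for the spanning subgraph (V(G), A). *)
Definition adj A : rel (vertex G) := [rel u v | [exists e in A, joins e u v]].

Definition component A v : {set vertex G} := [set u | connect (adj A) v u].

Definition component_edges A v : {set edge G} :=
  [set e in A | src e \in component A v].

Definition p0 A : nat := n_comp (adj A) (vertex G).

Definition path_vertices (p : seq (edge G)) : seq (vertex G) :=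
  if p is e :: _ then src e :: map tgt p else [::].

(* Distinctness of the n+1 vertices visited by e_1, ..., e_n rules out loops
   and the closing of the path into a cycle. *)
Definition simple_path (p : seq (edge G)) : bool :=
  [&& p != [::], sorted [rel e f | tgt e == src f] p & uniq (path_vertices p)].

Definition multipath A : bool :=
  [forall v,
     ((component A v == [set v]) && (component_edges A v == set0))
  || has [pred p | simple_path p
                 & component A v == [set u in path_vertices p]]
         (permutations (enum (component_edges A v)))].

Definition Mult : {set {set edge G}} := [set A | multipath A].

Definition coherent_cycle (c : seq (edge G)) : bool :=
  cycle [rel e f | tgt e == src f] c && uniq (map src c).

(* v_1, e_1, v_2, e_2, ..., v_n, e_n, v_1 with e_i joining v_i and v_(i+1):
   a cycle of the underlying undirected multigraph. A loop is such a cycle with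
   n = 1, and two opposite edges (v, w), (w, v) form one with n = 2. *)
Definition undirected_cycle (c : seq (vertex G * edge G)) : bool :=
  [&& c != [::], cycle [rel x y | joins x.2 x.1 y.1] c,
      uniq (unzip1 c) & uniq (unzip2 c)].

End SpanningSubgraphs.

Section Reversal.

Variable G : digraph.

Fact reversal_simple (e f : edge G) :
  tgt e <> src e -> tgt e = tgt f -> src e = src f -> e = f.
Proof. by move=> ne Et Es; apply: edge_simple => // /esym. Qed.

Definition reversal : digraph := Digraph reversal_simple.

End Reversal.

Section OrdDigraph.

Variables (n : nat) (s : seq (nat * nat)).

Let E := {x : 'I_n * 'I_n | (val x.1, val x.2) \in s}.

Fact ord_digraph_simple (e f : E) :
  (val e).1 <> (val e).2 -> (val e).1 = (val f).1 ->
  (val e).2 = (val f).2 -> e = f.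
Proof.
move=> _ E1 E2; apply: val_inj.
by rewrite [LHS]surjective_pairing [RHS]surjective_pairing E1 E2.
Qed.

(* The digraph on {0, ..., n-1} with edges the pairs in s. *)
Definition ord_digraph : digraph := Digraph ord_digraph_simple.

End OrdDigraph.

Definition D_A : digraph := ord_digraph 3 [:: (1, 0); (0, 2); (1, 2)].
Definition D_B : digraph := ord_digraph 4 [:: (0, 1); (2, 1); (2, 3)].

(* G has a (not necessarily induced) subgraph isomorphic to H. *)
Definition has_subgraph (H G : digraph) : Prop :=
  exists (phi : vertex H -> vertex G) (psi : edge H -> edge G),
    [/\ injective phi, injective psi,
        forall e, src (psi e) = phi (src e)
      & forall e, tgt (psi e) = phi (tgt e)].

Definition MP1 (G : digraph) : Prop :=
  [/\ ~ has_subgraph D_A G, ~ has_subgraph D_B G,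
      ~ has_subgraph (reversal D_A) G & ~ has_subgraph (reversal D_B) G].

Definition MP2 (G : digraph) : Prop :=
  forall c : seq (edge G), coherent_cycle c -> 2 <= size c ->
  forall v, v \in map src c ->
    component [set: edge G] v = [set u in map src c] /\
    component_edges [set: edge G] v = [set e in c].

Definition MP_digraph (G : digraph) : Prop := MP1 G /\ MP2 G.

Definition MP_forest (G : digraph) : Prop :=
  MP_digraph G /\ forall c : seq (vertex G * edge G), ~~ undirected_cycle c.

(* A matroid on the ground set X is given by its family I of independent sets;
   the multipath matroid M_G is given by the family Mult G. *)
Definition rank (X : finType) (I : {set {set X}}) (A : {set X}) : nat :=
  \max_(B in I | B \subset A) #|B|.

Local Open Scope ring_scope.

Definition tutte (X : finType) (I : {set {set X}}) (R : comNzRingType)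
    (x y : R) : R :=
  \sum_(A : {set X}) (x - 1) ^+ (rank I [set: X] - rank I A)
                     * (y - 1) ^+ (#|A| - rank I A).

(* The state sum of the graded Euler characteristic of multipath cohomology,
   alpha being the graded dimension of the coefficient algebra. *)
Definition chi_mu (G : digraph) (R : comNzRingType) (alpha : R) : R :=
  \sum_(m in Mult G) (-1) ^+ #|m| * alpha ^+ p0 m.

(* Main.v *)
Require Import Defs.
From mathcomp Require Import all_boot all_order all_algebra.

(** Since [y - 1 = 0], only the sets [A] with [r(A) = |A|], i.e. the multipaths,
    contribute to [T(1 - alpha, 1)].  In a forest every set of edges [A]
    satisfies [p0(A) + |A| = |V|], since adding an edge that closes no cycle
    merges exactly two components; hence [p0(m) = p0(G) + |E| - |m|] and the two
    sums agree term by term. *)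

Set Implicit Arguments.
Unset Strict Implicit.
Unset Printing Implicit Defensive.

Import GRing.Theory.

(** [n_comp] counts roots, and the root of [x] is picked from the set [connect e x] alone, so only
    connectivity from points of [a] matters. *)
Lemma n_comp_local (T : finType) (e e' : rel T) (a : {pred T}) :
  {in a, forall x, connect e x =1 connect e' x} -> n_comp e a = n_comp e' a.
Proof.
move=> eq_ee'; rewrite /n_comp_mem; apply: eq_card => x; rewrite !inE.
have [ax | _] := boolP (x \in a); last by rewrite !andbF.
by rewrite /roots /fingraph.root (eq_pick (eq_ee' x ax)).
Qed.

Section ComponentCount.

Variable G : digraph.
Implicit Types (A B : {set edge G}) (u v x : vertex G) (e f : edge G).

Lemma joins_sym e u v : joins e u v = joins e v u.
Proof. by rewrite /joins orbC. Qed.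

Lemma adj_sym A : symmetric (adj A).
Proof. by move=> u v; apply: eq_existsb => e; rewrite joins_sym. Qed.

Lemma connect_adj_sym A : connect_sym (adj A).
Proof. exact: sym_connect_sym (@adj_sym A). Qed.

Lemma connect_adj_sub A B :
  A \subset B -> subrel (connect (adj A)) (connect (adj B)).
Proof.
move=> /subsetP sAB; apply: connect_sub => u v /existsP[e /andP[eA euv]].
by apply/connect1/existsP; exists e; rewrite sAB.
Qed.

(** Puts a vertex path into the format of [undirected_cycle]: each vertex is paired with the edge
    leaving it, and the last one with [f], the edge meant to close the cycle. The final clause
    strengthens the induction so as to give distinct edges. *)
Lemma uniq_path_edges B f x (p : seq (vertex G)) :
    f \notin B -> path (adj B) x p -> uniq (x :: p) ->
  exists g s,
    [/\ unzip1 s = p, path [rel y z | joins y.2 y.1 z.1] (x, g) s,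
        (last (x, g) s).2 = f, uniq (g :: unzip2 s)
      & {in g :: unzip2 s, forall h,
          h = f \/ [/\ h \in B, src h \in x :: p & tgt h \in x :: p]}].
Proof.
move=> fB; elim: p x => [|y p IHp] x /=.
  by exists f, [::]; split=> // h; rewrite inE => /eqP; left.
case/andP=> /existsP[e /andP[eB exy]] yp /andP[xNp uyp].
have [g [s [s1 gs lgs ugs gsP]]] := IHp y yp uyp.
exists e, ((y, g) :: s); split=> //; first by rewrite /= s1.
- by rewrite /= exy.
(* The later edges other than [f] have both ends in [y :: p], whereas [e] has the end [x], which
   lies outside it. *)
- apply/andP; split=> //; apply/negP => /gsP[ef | [_ se te]].
    by rewrite -ef eB in fB.
  by case/negP: xNp; case/orP: exy => /andP[/eqP es /eqP et]; [rewrite -es | rewrite -et].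
- move=> h; rewrite inE => /predU1P[->|/gsP[->|[hB hs ht]]]; last first.
  + by right; rewrite hB !(in_cons x) hs ht !orbT.
  + by left.
  right; rewrite eB !inE.
  by case/orP: exy => /andP[-> ->]; rewrite !orbT.
Qed.

Hypothesis acyclic : forall c : seq (vertex G * edge G), ~~ undirected_cycle c.

(** A repetition-free path from [tgt e] to [src e] in [B] would be closed by [e] into an undirected
    cycle; a loop [e] is the case of the empty path. *)
Lemma acyclic_not_connect B e :
  e \notin B -> ~~ connect (adj B) (tgt e) (src e).
Proof.
move=> eB; apply/negP => /connectP[q /shortenP[p tp utp _] lp].
have [g [s [s1 gs lgs ugs _]]] := uniq_path_edges eB tp utp.
case/negP: (acyclic ((tgt e, g) :: s)); rewrite /undirected_cycle /=.
rewrite s1 -/(uniq (tgt e :: p)) utp -/(uniq (g :: unzip2 s)) ugs !andbT.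
rewrite rcons_path gs /= lgs.
have -> : (last (tgt e, g) s).1 = src e.
  by rewrite lp -s1 -(last_map fst).
by rewrite /joins !eqxx.
Qed.

(** The [B]-component of [u] contains neither end of [e], so it stays closed under adjacency once
    [e] is added. *)
Lemma connect_addN B e u :
    ~~ connect (adj B) (tgt e) u -> ~~ connect (adj B) (src e) u ->
  connect (adj (e |: B)) u =1 connect (adj B) u.
Proof.
move=> tu su v; apply/idP/idP; last exact/connect_adj_sub/subsetUr.
have cB : closed (adj (e |: B)) (connect (adj B) u).
  apply: (intro_closed (connect_adj_sym _)) => x y /existsP[f].
  rewrite !inE => /andP[/predU1P[-> | fB] fxy] ux.
    rewrite (connect_adj_sym B) in tu; rewrite (connect_adj_sym B) in su.
    by case/orP: fxy ux => /andP[/eqP <- /eqP <-] ux;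
      [case/negP: su | case/negP: tu].
  by apply: connect_trans ux (connect1 _); apply/existsP; exists f; rewrite fB.
by move/(closed_connect cB); rewrite !inE connect0 => <-.
Qed.

Lemma p0_add B e : e \notin B -> p0 B = (p0 (e |: B)).+1.
Proof.
move=> eB; have ntes := acyclic_not_connect eB.
(* The vertices are split into [a], the union of the [B]-components of the two ends of [e], and its
   complement, where adding [e] changes nothing. *)
pose a := closure (adj B) (pred2 (tgt e) (src e)).
have aP u : (u \in a) = connect (adj B) (tgt e) u || connect (adj B) (src e) u.
  rewrite (connect_adj_sym B (tgt e)) (connect_adj_sym B (src e)).
  apply/pred0Pn/orP => [[v /andP[uv /pred2P[]]] | [] uv].
  - by move=> <-; left.
  - by move=> <-; right.
  - by exists (tgt e); rewrite !inE uv eqxx.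
  - by exists (src e); rewrite !inE uv eqxx orbT.
have cst : connect (adj (e |: B)) (tgt e) (src e).
  apply/connect1/existsP; exists e.
  by rewrite setU11 /joins !eqxx orbT.
have sBA := @connect_adj_sub B (e |: B) (subsetUr _ _).
have eqC : {in predC a, forall u, connect (adj (e |: B)) u =1 connect (adj B) u}.
  move=> u ua; have: u \notin a by [].
  by rewrite aP negb_or => /andP[tu su]; apply: connect_addN.
have eqa : a =i connect (adj (e |: B)) (tgt e).
  move=> u; apply/idP/idP => [|tu].
    rewrite aP => /orP[/sBA // | /sBA su]; exact: connect_trans cst su.
  (* A vertex outside [a] keeps its [B]-component, so a link to [tgt e] would already exist in
     [B]. *)
  apply: contraT => ua; have uC : u \in predC a by [].
  have := tu; rewrite -topredE /= (connect_adj_sym (e |: B)) eqC //.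
  by rewrite (connect_adj_sym B) => tu'; rewrite aP tu' in ua.
rewrite /p0 (n_compC a) [in RHS](n_compC a).
(* On [a] there are two components for [B] and one for [e |: B]. *)
rewrite (n_comp_closure2 (connect_adj_sym B)) ntes (n_comp_local eqC).
by rewrite (eq_n_comp_r eqa) (n_comp_connect (connect_adj_sym _)).
Qed.

Lemma p0_acyclic A : p0 A + #|A| = #|vertex G|.
Proof.
elim: {A}_.+1 {-2}A (ltnSn #|A|) => // n IHn A; rewrite ltnS => leAn.
have [-> | [e eA]] := set_0Vmem A; last first.
  have eB : e \notin A :\ e by rewrite setD11.
  rewrite (cardsD1 e) eA -[in p0 A](setD1K eA) add1n addnS -addSn -(p0_add eB).
  by apply: IHn; rewrite (cardsD1 e) eA in leAn.
(* Without edges every vertex is its own root. *)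
rewrite cards0 addn0 /p0 /n_comp_mem; apply: eq_card => x; rewrite !inE andbT.
rewrite /roots; case/connectP: (connect_root (adj set0) x) => [[|y p] /=].
  by move=> _ ->; rewrite eqxx.
by case/andP=> /existsP[f]; rewrite inE.
Qed.

End ComponentCount.

Lemma multipath0 (G : digraph) : set0 \in Mult G.
Proof.
rewrite inE; apply/forallP => v; apply/orP; left; apply/andP; split.
  apply/eqP/setP => u; rewrite !inE; apply/idP/eqP => [|->]; last exact: connect0.
  by case/connectP=> [[|y p] /= // /andP[/existsP[f]]]; rewrite inE.
by apply/eqP/setP => f; rewrite !inE.
Qed.

Section Rank.

Variables (X : finType) (I : {set {set X}}).
Implicit Types A B : {set X}.

Lemma rank_le_card A : rank I A <= #|A|.
Proof. by apply/bigmax_leqP => B /andP[_ /subset_leq_card]. Qed.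

Lemma rank_indep A : A \in I -> rank I A = #|A|.
Proof.
move=> AI; apply/eqP; rewrite eqn_leq rank_le_card.
by apply: (bigmax_sup A); rewrite ?AI /=.
Qed.

Lemma rank_mono A B : A \subset B -> rank I A <= rank I B.
Proof.
move=> sAB; apply/bigmax_leqP => C /andP[CI sCA].
by apply: (bigmax_sup C); rewrite // CI (subset_trans sCA).
Qed.

Hypothesis I0 : set0 \in I.

(** By [I0] the maximum defining the rank is attained, at some independent [B] inside [A]; if the
    rank is at least [#|A|], then [B = A]. *)
Lemma card_sub_rank_eq0 A : (#|A| - rank I A == 0) = (A \in I).
Proof.
apply/idP/idP => [|AI]; last by rewrite rank_indep // subnn.
rewrite subn_eq0 /rank.
have I0A : 0 < #|[pred B in I | B \subset A]|.
  by apply/card_gt0P; exists set0; rewrite inE I0 sub0set.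
have [B /andP[BI sBA] ->] := eq_bigmax_cond (fun B : {set X} => #|B|) I0A.
by move=> leAB; have /eqP <- : B == A by rewrite eqEcard sBA.
Qed.

Lemma tutte_y1 (R : comNzRingType) (x : R) :
  (tutte I x 1 = \sum_(A in I) (x - 1) ^+ (rank I [set: X] - #|A|))%R.
Proof.
rewrite /tutte [RHS]big_mkcond; apply: eq_bigr => A _.
rewrite subrr expr0n card_sub_rank_eq0; have [AI | _] := boolP (A \in I).
  by rewrite (rank_indep AI) mulr1.
by rewrite mulr0.
Qed.

End Rank.

Local Open Scope ring_scope.

Theorem theorem6p3 (G : digraph) (hG : MP_forest G) :
  let alpha : {poly int} := 'X in
  let r := rank (Mult G) in
  let E := [set: edge G] in
  chi_mu G alpha =
    (-1) ^+ r E * alpha ^+ (#|E| - r E) * alpha ^+ p0 E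
    * tutte (Mult G) (1 - alpha) 1.
Proof.
move=> alpha r E; case: hG => _ acyclic.
rewrite tutte_y1 ?multipath0 // /chi_mu mulr_sumr; apply: eq_bigr => m mM.
have le_mr : (#|m| <= r E)%N.
  by rewrite -(rank_indep mM); apply/rank_mono/subsetT.
have le_rE : (r E <= #|E|)%N by apply: rank_le_card.
(* Comparing the vertex counts for [m] and [E] gives the difference [#|E| - #|m|], split at [r E] to
   match the three powers of [alpha]. *)
have -> : p0 m = (#|E| - r E + p0 E + (r E - #|m|))%N.
  apply/eqP; rewrite -(eqn_add2r #|m|) p0_acyclic // -addnA subnK //.
  by rewrite addnAC subnK // addnC p0_acyclic.
(* Here [x - 1] is [- alpha], whose sign is split off. *)
rewrite addrAC subrr add0r -/r -/E (exprNn alpha) !exprD.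
(* The exponents on the two sides differ by twice [r E - #|m|]. *)
have -> : (-1) ^+ #|m| = (-1) ^+ r E * (-1) ^+ (r E - #|m|) :> {poly int}.
  by rewrite -{1}(subnK le_mr) exprD mulrAC -expr2 sqrr_sign mul1r.
rewrite !mulrA; congr (_ * _).
by rewrite [RHS]mulrAC; congr (_ * _); apply: mulrAC.
Qed.
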